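(* Let $k\ge1$ and let $v_1,\dots,v_n\in\mathbb{R}^d$ be an arbitrary (fixed) sequence of $n$ vectors containing at least $k+1$ distinct vectors, and let $W^*$ be the optimal $k$-means cost of this multiset. Run the fully online $k$-means algorithm (described in the context) on the sequence, and let $W=\sum_{t=1}^n\|v_t-c_t\|^2$ be the cost of its online assignments, where $c_t$ is the center output for $v_t$ at the time $v_t$ is processed. Then $$\mathbb{E}[W]=O(W^*\log n),$$ where the expectation is over the algorithm's internal randomness and the constant in $O(\cdot)$ is absolute.
   Context: Norms are Euclidean, and $\log$ denotes the base-2 logarithm. The optimal $k$-means cost of vectors $v_1,\dots,v_n$ is $W^*=\min\sum_{i=1}^k\sum_{v\in S_i}\|v-c_i\|_2^2$, the minimum taken over all partitions of the vectors into $k$ sets $S_1,\dots,S_k$ and all choices of centers $c_1,\dots,c_k\in\mathbb{R}^d$. For a point $v$ and a finite set $C$, $D(v,C)=\min_{c\in C}\|v-c\|$. Fully online $k$-means algorithm (input: the stream and $k$; the length of the stream is not known to it): let $C$ be the set of the first $k+1$ distinct vectors of the stream, each of which is output as its own center, and set a counter $m\gets k+1$. Set $w^*\gets\min_{v\ne v'\in C}\|v-v'\|^2/2$, $r\gets1$, $q_1\gets0$, $f_1\gets w^*/k$. For each remaining vector $v$ of the stream, in order: set $m\gets m+1$; with probability $p=\min(D^2(v,C)/f_r,1)$ (independently of all other random choices), set $C\gets C\cup\{v\}$ and $q_r\gets q_r+1$; then, if $q_r\ge 3k(1+\log m)$, set $r\gets r+1$, $q_r\gets0$, $f_r\gets2f_{r-1}$;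 finally output (assign $v$ to) the center $c=\arg\min_{c\in C}\|v-c\|^2$. *)

(* Defs.v *)
From HB Require Import structures.
From mathcomp Require Import all_boot all_order all_algebra.
From mathcomp Require Import all_classical all_reals all_analysis.
From mathcomp Require Import ring lra.

Set Implicit Arguments.
Unset Strict Implicit.
Unset Printing Implicit Defensive.

Import Order.TTheory GRing.Theory Num.Theory.

Local Open Scope classical_set_scope.
Local Open Scope ring_scope.

(* The norm that the analysis library puts on 'rV[R]_d is the sup norm. *)
Definition enorm (R : realType) (d : nat) (x : 'rV[R]_d) : R :=
  Num.sqrt (\sum_(j < d) x 0 j ^+ 2).

Definition log2 (R : realType) (x : R) : R := ln x / ln 2.

(* Only meaningful on nonempty sequences. *)
Definition seqmin (R : realType) (s : seq R) : R :=
  \big[Num.min/head 0 s]_(x <- s) x.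

(* The partition is S_i = {t | a t = i}; the S_i are sets of positions of the
   stream, so repeated vectors count with multiplicity. *)
Definition kmeans_cost (R : realType) (d k n : nat) (v : n.-tuple 'rV[R]_d)
    (a : {ffun 'I_n -> 'I_k}) (c : 'I_k -> 'rV[R]_d) : R :=
  \sum_(i < k) \sum_(t < n | a t == i) enorm (tnth v t - c i) ^+ 2.

(* The infimum is a minimum: see kmeans_opt_attained. *)
Definition kmeans_opt (R : realType) (d k n : nat) (v : n.-tuple 'rV[R]_d) : R :=
  inf [set w | exists a : {ffun 'I_n -> 'I_k},
               exists c : 'I_k -> 'rV[R]_d, w = kmeans_cost v a c].

Definition dist_to (R : realType) (d : nat) (v : 'rV[R]_d) (C : seq 'rV[R]_d) : R :=
  seqmin [seq enorm (v - c) | c <- C].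

(* Ties are broken in favour of the center that was opened first. *)
Definition nearest (R : realType) (d : nat) (v : 'rV[R]_d) (C : seq 'rV[R]_d) :
    'rV[R]_d :=
  head 0 [seq c <- C |
            all (fun c' => enorm (v - c) ^+ 2 <= enorm (v - c') ^+ 2) C].

(* Finitely supported distributions, as lists of (probability, value) pairs. *)
Definition dist (R : realType) (A : Type) : Type := seq (R * A).

Definition dret (R : realType) (A : Type) (x : A) : dist R A := [:: (1, x)].

Definition dbind (R : realType) (A B : Type) (mu : dist R A) (g : A -> dist R B) :
    dist R B :=
  [seq (w.1 * u.1, u.2) | w <- mu, u <- g w.2].

Definition dflip (R : realType) (p : R) : dist R bool :=
  [:: (p, true); (1 - p, false)].

Definition expect (R : realType) (A : Type) (mu : dist R A) (F : A -> R) : R :=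
  \sum_(w <- mu) w.1 * F w.2.

(* Current C, m, f_r and q_r; the value of r itself is never consulted. *)
Record state (R : realType) (d : nat) : Type := State {
  centers : seq 'rV[R]_d;
  seen : nat;
  facility : R;
  opened : nat }.

(* split_stream j [::] s = (the first j distinct vectors of s, the remaining
   vectors of s in order); C holds the distinct vectors found so far. *)
Fixpoint split_stream (R : realType) (d : nat) (j : nat) (C s : seq 'rV[R]_d) :
    seq 'rV[R]_d * seq 'rV[R]_d :=
  if s is v :: s' then
    if (size C < j)%N && (v \notin C) then split_stream j (rcons C v) s'
    else let: (C', rest) := split_stream j C s' in (C', v :: rest)
  else (C, [::]).

Definition wstar0 (R : realType) (d : nat) (C : seq 'rV[R]_d) : R :=
  seqmin [seq enorm (p.1 - p.2) ^+ 2 / 2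
         | p <- [seq (x, y) | x <- C, y <- C] & p.1 != p.2].

Definition init_state (R : realType) (d k : nat) (C : seq 'rV[R]_d) : state R d :=
  State C k.+1 (wstar0 C / k%:R) 0.

Definition open_prob (R : realType) (d : nat) (st : state R d) (v : 'rV[R]_d) : R :=
  Num.min (dist_to v (centers st) ^+ 2 / facility st) 1.

Definition step (R : realType) (d k : nat) (st : state R d) (v : 'rV[R]_d)
    (b : bool) : state R d :=
  let m := (seen st).+1 in
  let C := if b then rcons (centers st) v else centers st in
  let q := (opened st + b)%N in
  if 3 * k%:R * (1 + log2 m%:R) <= q%:R :> R
  then State C m (2 * facility st) 0
  else State C m (facility st) q.

(* The law of the list of pairs (vector, center it is assigned to). *)
Fixpoint process (R : realType) (d k : nat) (st : state R d) (s : seq 'rV[R]_d) :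
    dist R (seq ('rV[R]_d * 'rV[R]_d)) :=
  if s is v :: s' then
    dbind (dflip (open_prob st v)) (fun b =>
      let st' := step k st v b in
      dbind (process k st' s') (fun out =>
        dret R ((v, nearest v (centers st')) :: out)))
  else dret R [::].

Definition online_kmeans (R : realType) (d k : nat) (s : seq 'rV[R]_d) :
    dist R (seq ('rV[R]_d * 'rV[R]_d)) :=
  let: (C, rest) := split_stream k.+1 [::] s in
  dbind (process k (init_state k C) rest) (fun out =>
    dret R ([seq (c, c) | c <- C] ++ out)).

Definition assignment_cost (R : realType) (d : nat)
    (out : seq ('rV[R]_d * 'rV[R]_d)) : R :=
  \sum_(vc <- out) enorm (vc.1 - vc.2) ^+ 2.

Lemma sqr_enorm (R : realType) (d : nat) (x : 'rV[R]_d) :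
  enorm x ^+ 2 = \sum_(j < d) x 0 j ^+ 2.
Proof. by rewrite sqr_sqrtr// sumr_ge0// => j _; exact: sqr_ge0. Qed.

Lemma centroid_min (R : realType) (d n : nat) (P : pred 'I_n)
    (x : 'I_n -> 'rV[R]_d) :
  exists mu : 'rV[R]_d, forall c,
  \sum_(t | P t) enorm (x t - mu) ^+ 2 <= \sum_(t | P t) enorm (x t - c) ^+ 2.
Proof.
pose N : R := \sum_(t | P t) 1.
have sumP (e : R) : \sum_(t | P t) e = N * e.
  by rewrite /N mulr_suml; apply: eq_bigr => t _; rewrite mul1r.
case: (pickP P) => [t0 Pt0|P0]; last by exists 0 => c; rewrite !big_pred0.
have N1 : 0 < N by rewrite /N (bigD1 t0)//= ltr_pwDl// sumr_ge0.
exists (N^-1 *: \sum_(t | P t) x t) => c.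
under eq_bigr do rewrite sqr_enorm.
under [leRHS]eq_bigr do rewrite sqr_enorm.
rewrite exchange_big [leRHS]exchange_big/=; apply: ler_sum => j _.
under eq_bigr do rewrite !mxE summxE.
under [leRHS]eq_bigr do rewrite !mxE.
set S := \sum_(t | P t) x t 0 j.
have E (e : R) : \sum_(t | P t) (x t 0 j - e) ^+ 2 =
    \sum_(t | P t) x t 0 j ^+ 2 - 2 * e * S + N * e ^+ 2.
  rewrite -(sumP (e ^+ 2)) /S mulr_sumr -sumrB -big_split/=.
  by apply: eq_bigr => t _; ring.
rewrite !E -subr_ge0.
have -> : \sum_(t | P t) x t 0 j ^+ 2 - 2 * c 0 j * S + N * c 0 j ^+ 2 -
    (\sum_(t | P t) x t 0 j ^+ 2 - 2 * (N^-1 * S) * S + N * (N^-1 * S) ^+ 2) =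
    N * (c 0 j - N^-1 * S) ^+ 2 by field; rewrite gt_eqF.
by rewrite mulr_ge0 ?sqr_ge0 ?ltW.
Qed.

Lemma kmeans_opt_attained (R : realType) (d k n : nat) (v : n.-tuple 'rV[R]_d) :
  (0 < k)%N ->
  exists (a : {ffun 'I_n -> 'I_k}) c, kmeans_opt k v = kmeans_cost v a c /\
    forall (a' : {ffun 'I_n -> 'I_k}) c', kmeans_cost v a c <= kmeans_cost v a' c'.
Proof.
move=> k0.
have /choice[mu muP] (a : {ffun 'I_n -> 'I_k}) : exists m : 'I_k -> 'rV[R]_d,
    forall c, kmeans_cost v a m <= kmeans_cost v a c.
  have /choice[m mP] i := centroid_min (fun t => a t == i) (tnth v).
  by exists m => c; apply: ler_sum => i _; exact: mP.
pose a := [arg min_(a < [ffun _ => Ordinal k0] : {ffun 'I_n -> 'I_k})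
             kmeans_cost v a (mu a)]%O.
have aP (a' : {ffun 'I_n -> 'I_k}) c' :
    kmeans_cost v a (mu a) <= kmeans_cost v a' c'.
  apply: le_trans (muP a' c'); rewrite /a.
  by case: arg_minP => //= b _; exact.
exists a, (mu a); split=> //; apply/eqP; rewrite eq_le; apply/andP; split.
  apply: ge_inf; last by exists a, (mu a).
  by exists (kmeans_cost v a (mu a)) => _ [a' [c' ->]].
apply: lb_le_inf; first by exists (kmeans_cost v a (mu a)), a, (mu a).
by move=> _ [a' [c' ->]].
Qed.

Lemma perm_split_stream (R : realType) (d j : nat) (C s : seq 'rV[R]_d) :
  perm_eq ((split_stream j C s).1 ++ (split_stream j C s).2) (C ++ s).
Proof.
elim: s C => [|v s IH] C //=.
case: ifP => _; first by rewrite (permPl (IH _)) cat_rcons.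
have := IH C; case: (split_stream j C s) => C' r /= H.
by rewrite -(cat1s v r) -(cat1s v s) perm_catCA [perm_eq _ (C ++ _)]perm_sym
           perm_catCA perm_cat2l perm_sym.
Qed.

Lemma expect_dret (R : realType) (A : Type) (x : A) (F : A -> R) :
  expect (dret R x) F = F x.
Proof. by rewrite /expect big_seq1 mul1r. Qed.

Lemma expect_dbind (R : realType) (A B : Type) (mu : dist R A)
    (g : A -> dist R B) (F : B -> R) :
  expect (dbind mu g) F = expect mu (fun x => expect (g x) F).
Proof.
rewrite /expect /dbind big_allpairs_dep/=; apply: eq_bigr => w _.
by rewrite mulr_sumr; apply: eq_bigr => u _; rewrite mulrA.
Qed.

Lemma expect_dflip (R : realType) (p : R) (F : bool -> R) :
  expect (dflip p) F = p * F true + (1 - p) * F false.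
Proof. by rewrite /expect big_cons big_seq1. Qed.

Lemma expect_online_kmeans1 (R : realType) (d k : nat) (s : seq 'rV[R]_d) :
  expect (online_kmeans k s) (fun=> 1) = 1.
Proof.
have D A B (mu : dist R A) (h : A -> B) :
    expect (dbind mu (fun x => dret R (h x))) (fun=> 1) = expect mu (fun=> 1).
  by rewrite expect_dbind; apply: eq_bigr => w _; rewrite expect_dret.
have H st r : expect (@process R d k st r) (fun=> 1) = 1.
  elim: r st => [|v r IH] st /=; first by rewrite expect_dret.
  by rewrite expect_dbind expect_dflip /= !D !IH; ring.
rewrite /online_kmeans; case: split_stream => C r.
by rewrite D.
Qed.

Lemma seqmin_ge0 (R : realType) (s : seq R) :
  all (fun x => 0 <= x) s -> 0 <= seqmin s.
Proof.
move=> s0; rewrite /seqmin.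
have : 0 <= head 0 s by case: s s0 => //= x s /andP[].
elim: s (head 0 s) s0 => [|x s IH] h /=; first by rewrite big_nil.
by move=> /andP[x0 s0] h0; rewrite big_cons le_min x0 IH.
Qed.

Lemma expect_online_kmeans_ge0 (R : realType) (d k : nat) (s : seq 'rV[R]_d)
    (F : seq ('rV[R]_d * 'rV[R]_d) -> R) :
  (forall out, 0 <= F out) -> 0 <= expect (online_kmeans k s) F.
Proof.
have H st r G : 0 <= facility st -> (forall out, 0 <= G out) ->
    0 <= expect (@process R d k st r) G.
  elim: r st G => [|v r IH] st G f0 G0 /=; first by rewrite expect_dret.
  rewrite expect_dbind expect_dflip !expect_dbind.
  have fS b : 0 <= facility (step k st v b).
    by rewrite /step; case: ifP => //= _; rewrite mulr_ge0.
  have p0 : 0 <= open_prob st v by rewrite le_min ler01 divr_ge0 ?sqr_ge0.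
  have p1 : 0 <= 1 - open_prob st v by rewrite subr_ge0 ge_min lexx orbT.
  by apply: addr_ge0; apply: mulr_ge0 => //; apply: IH => // out;
     rewrite expect_dret.
move=> F0; rewrite /online_kmeans; case: split_stream => C r.
rewrite expect_dbind; apply: H => [|out]; last by rewrite expect_dret.
rewrite divr_ge0// seqmin_ge0//; apply/allP => _ /mapP[p _ ->].
by rewrite divr_ge0 ?sqr_ge0.
Qed.

(* Main.v *)
Require Import Defs.
From HB Require Import structures.
From mathcomp Require Import all_boot all_order all_algebra.
From mathcomp Require Import all_classical all_reals all_analysis.
From mathcomp Require Import ring lra zify.

Set Implicit Arguments.
Unset Strict Implicit.
Unset Printing Implicit Defensive.

Import Order.TTheory GRing.Theory Num.Theory.

Local Open Scope ring_scope.

(** Fix optimal centers [c_i] and let [W] be the optimal cost.  A step with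
    facility cost [f] costs in expectation at most [f] times the probability of
    opening, and a phase opens at most [T = 3 k (1 + log n) + 1] centers.  When
    [v], the [m]-th vector, is opened, either
    [D^2(v, C) <= 9 |v - c_i|^2 + 4 W / m^2], and the opening is charged, or [v]
    is at least twice as close to [c_i] as [C] was; the latter happens at most
    [2 + log m] times per cluster, whatever the phase.  Hence a phase ends only
    after [k] charged openings, while the expected sum of [f] over all charged
    openings, in all phases, is at most [13 W].  Weighting charged openings by
    [4 T / k] yields the potential
      [f (T - q) + (4 T / k) (f z + 9 sum |v - c_i|^2 + 4 W / m)]
    ([z] charged openings in the phase, sum over the vectors to come), which
    bounds the expected future cost even across phase changes; initially it is
    [O (T W / k)]. *)

(** * Minima of sequences, distances and nearest centers *)

Lemma seqmin_le (R : realType) (s : seq R) (x : R) : x \in s -> seqmin s <= x.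
Proof.
rewrite /seqmin; elim: s (head 0 s) => //= y s IH h.
rewrite inE big_cons ge_min => /predU1P[->|/IH ->]; first by rewrite lexx.
by rewrite orbT.
Qed.

Lemma seqmin_mem (R : realType) (s : seq R) : s != [::] -> seqmin s \in s.
Proof.
have H (r : seq R) h : \big[Num.min/h]_(x <- r) x \in h :: r.
  elim: r => [|y r IH]; first by rewrite big_nil mem_head.
  rewrite big_cons minEle; case: ifP => _; first by rewrite !inE eqxx orbT.
  by move: IH; rewrite !inE => /orP[->//|->]; rewrite !orbT.
case: s => // x s _; have := H (x :: s) x.
by rewrite /seqmin !inE orbA orbb.
Qed.

Lemma dist_to_le (R : realType) (d : nat) (v c : 'rV[R]_d) (C : seq 'rV[R]_d) :
  c \in C -> dist_to v C ^+ 2 <= enorm (v - c) ^+ 2.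
Proof.
move=> cC; have D0 : 0 <= dist_to v C.
  by apply: seqmin_ge0; apply/allP => _ /mapP[x _ ->]; exact: sqrtr_ge0.
rewrite ler_sqr ?nnegrE ?sqrtr_ge0//; apply: seqmin_le.
exact: (map_f (fun x => enorm (v - x))).
Qed.

Lemma dist_to_attained (R : realType) (d : nat) (v : 'rV[R]_d)
    (C : seq 'rV[R]_d) :
  C != [::] -> exists2 c, c \in C & dist_to v C = enorm (v - c).
Proof.
move=> C0; have : [seq enorm (v - c) | c <- C] != [::] by case: C C0.
by move=> /seqmin_mem/mapP[c cC e]; exists c.
Qed.

Lemma nearest_le (R : realType) (d : nat) (v c : 'rV[R]_d) (C : seq 'rV[R]_d) :
  c \in C -> enorm (v - nearest v C) ^+ 2 <= enorm (v - c) ^+ 2.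
Proof.
move=> cC.
have C0 : C != [::] by case: C cC.
rewrite /nearest; set P := fun c => all _ C.
(* A minimiser passes the filter, so [head] never returns its default 0. *)
have [x xC xD] := dist_to_attained v C0.
have Px : P x by apply/allP => y yC; rewrite -xD dist_to_le.
have: head 0 [seq c <- C | P c] \in [seq c <- C | P c].
  have : x \in [seq c <- C | P c] by rewrite mem_filter Px.
  by case: [seq c <- C | P c] => //= *; rewrite mem_head.
by rewrite mem_filter => /andP[/allP/(_ _ cC)].
Qed.

(* [- 2 a b <= 2 a^2 + b^2 / 2], coordinatewise *)
Lemma sqr_enormB_le (R : realType) (d : nat) (x y z : 'rV[R]_d) :
  enorm (x - y) ^+ 2 <= 3 * enorm (x - z) ^+ 2 + 3 / 2 * enorm (y - z) ^+ 2.
Proof.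
rewrite !sqr_enorm !mulr_sumr -big_split/=; apply: ler_sum => j _; rewrite !mxE.
rewrite -subr_ge0 (_ : _ - _ = 2 * ((x 0 j - z 0 j) + (y 0 j - z 0 j) / 2) ^+ 2).
  by rewrite mulr_ge0 ?sqr_ge0.
by field.
Qed.

Lemma enorm_eq0 (R : realType) (d : nat) (x : 'rV[R]_d) :
  enorm x ^+ 2 = 0 -> x = 0.
Proof.
rewrite sqr_enorm => /psumr_eq0P x0; apply/rowP => j; rewrite mxE.
by apply/eqP; rewrite -sqrf_eq0 x0// => i _; exact: sqr_ge0.
Qed.

(** * Expected cost of one step *)

Lemma expect_process1 (R : realType) (d k : nat) (st : state R d)
    (s : seq 'rV[R]_d) : expect (process k st s) (fun=> 1) = 1.
Proof.
elim: s st => [|v s IH] st /=; first by rewrite expect_dret.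
have D (A B : Type) (mu : dist R A) (h : A -> B) :
    expect (dbind mu (fun x => dret R (h x))) (fun=> 1) = expect mu (fun=> 1).
  by rewrite expect_dbind; apply: eq_bigr => w _; rewrite expect_dret.
by rewrite expect_dbind expect_dflip /= !D !IH; ring.
Qed.

Lemma expect_process_cons (R : realType) (d k : nat) (st : state R d)
    (v : 'rV[R]_d) (s : seq 'rV[R]_d) (p := open_prob st v)
    (V := fun b => enorm (v - nearest v (centers (step k st v b))) ^+ 2 +
      expect (process k (step k st v b) s) (@assignment_cost R d)) :
  expect (process k st (v :: s)) (@assignment_cost R d) =
    p * V true + (1 - p) * V false.
Proof.
have E b : expect (dbind (process k (step k st v b) s) (fun out =>
      dret R ((v, nearest v (centers (step k st v b))) :: out)))
      (@assignment_cost R d) = V b.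
  (* Total mass 1 lets the fixed cost of [v] move inside the expectation. *)
  rewrite expect_dbind /V -[X in X + _]mulr1.
  rewrite -[X in _ * X + _](expect_process1 k (step k st v b) s).
  rewrite /expect mulr_sumr -big_split; apply: eq_bigr => w _ /=.
  by rewrite big_seq1 /assignment_cost big_cons/=; ring.
by rewrite /= expect_dbind expect_dflip !E.
Qed.

Lemma centers_step (R : realType) (d k : nat) (st : state R d) (v : 'rV[R]_d) b :
  centers (step k st v b) = if b then rcons (centers st) v else centers st.
Proof. by rewrite /step; case: ifP. Qed.

(* Either [p = 1] and [v] is its own center, or [p * f] is exactly the squared
   distance: the cost of a step is paid for by [f] per opened center. *)
Lemma process_cost_cons (R : realType) (d k : nat) (st : state R d)
    (v : 'rV[R]_d) (s : seq 'rV[R]_d) (p := open_prob st v)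
    (V := fun b =>
      expect (process k (step k st v b) s) (@assignment_cost R d)) :
  0 < facility st -> centers st != [::] ->
  expect (process k st (v :: s)) (@assignment_cost R d) <=
    p * (facility st + V true) + (1 - p) * V false.
Proof.
move=> f0 C0; rewrite expect_process_cons -/p !centers_step.
have -> : enorm (v - nearest v (rcons (centers st) v)) ^+ 2 = 0.
  apply/eqP; rewrite eq_le sqr_ge0 andbT.
  apply: le_trans (nearest_le v _ : _ <= enorm (v - v) ^+ 2) _.
    by rewrite mem_rcons mem_head.
  by rewrite subrr sqr_enorm big1// => j _; rewrite mxE expr0n.
set D := enorm _ ^+ 2; rewrite -/(V true) -/(V false).
suff : (1 - p) * D <= p * facility st by lra.
have D_le : D <= dist_to v (centers st) ^+ 2.
  by have [c cC ->] := dist_to_attained v C0; exact: nearest_le.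
have D0 : 0 <= D by exact: sqr_ge0.
rewrite /p /open_prob minEle; case: ifP => _.
  rewrite divfK ?gt_eqF//; apply: le_trans D_le; rewrite ler_piMl// gerBl.
  by rewrite divr_ge0 ?sqr_ge0 ?ltW.
by rewrite subrr !(mul0r, mul1r) ltW.
Qed.

(** * Logarithms, and the accounting of openings in a phase *)

Lemma ler_log2 (R : realType) (x y : R) : 0 < x -> x <= y -> log2 x <= log2 y.
Proof.
move=> x0 xy; have y0 := lt_le_trans x0 xy.
by rewrite ler_pM2r ?invr_gt0 ?ln_gt0 ?ltr1n// ler_ln ?posrE.
Qed.

Lemma log2X (R : realType) (n : nat) : log2 (2 ^+ n) = n%:R :> R.
Proof.
by rewrite /log2 lnXn// -[_ *+ n]mulr_natl mulfK// gt_eqF ?ln_gt0 ?ltr1n.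
Qed.

Lemma log2M (R : realType) (x y : R) :
  0 < x -> 0 < y -> log2 (x * y) = log2 x + log2 y.
Proof. by move=> x0 y0; rewrite /log2 lnM ?posrE// mulrDl. Qed.

Lemma log2_ge0 (R : realType) (m : nat) : (0 < m)%N -> 0 <= log2 m%:R :> R.
Proof. by move=> m0; rewrite divr_ge0 ?ln_ge0 ?ler1n. Qed.

(* [q] openings in the phase, [z] of them charged; [u i] counts the others in
   the cluster of [c i]. *)
Definition accounting (R : realType) (d k : nat) (c : 'I_k -> 'rV[R]_d) (W : R)
    (C : seq 'rV[R]_d) (m q z : nat) :=
  exists u : 'I_k -> nat,
    [/\ (q <= z + \sum_i u i)%N,
        forall i, (2 ^ u i <= 4 * m)%N
      & forall i, u i = 0%N \/
          exists2 x, x \in C & 4 ^+ u i * enorm (x - c i) ^+ 2 <= 4 * W].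

Lemma accounting0 (R : realType) (d k : nat) (c : 'I_k -> 'rV[R]_d) (W : R)
    (C : seq 'rV[R]_d) (m : nat) : (0 < m)%N -> accounting c W C m 0 0.
Proof. by move=> m0; exists (fun=> 0%N); split=> // i; [lia|left]. Qed.

(** An uncharged opening increments [u i]: [v] is at most half as far from [c i] as any older
    center, so it is the new witness of the third clause; the term in [4 * W] keeps older centers
    far enough from [c i] for the second. *)
Lemma accounting_step (R : realType) (d k : nat) (c : 'I_k -> 'rV[R]_d) (W : R)
    (C : seq 'rV[R]_d) (m q z : nat) (v : 'rV[R]_d) (i : 'I_k) (b : bool) :
  0 < W -> enorm (v - c i) ^+ 2 <= W -> accounting c W C m q z ->
  accounting c W (if b then rcons C v else C) m.+1 (q + b)
    (z + (b && (dist_to v C ^+ 2 <=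
                9 * enorm (v - c i) ^+ 2 + 4 * W / m.+1%:R ^+ 2))).
Proof.
move=> W0 vW [u [qu um uC]].
have um1 j : (2 ^ u j <= 4 * m.+1)%N by rewrite (leq_trans (um j)) ?leq_mul.
case: b => /=; last by exists u; split=> //; rewrite !addn0.
case: leP => [_|far].
  exists u; split=> // [|j]; first lia.
  have [->|[x xC ux]] := uC j; [by left|right; exists x => //].
  by rewrite mem_rcons inE xC orbT.
have near x : x \in C ->
    4 * enorm (v - c i) ^+ 2 <= enorm (x - c i) ^+ 2 /\
    W / m.+1%:R ^+ 2 < enorm (x - c i) ^+ 2.
  move=> xC; have := dist_to_le v xC; have := sqr_enormB_le v x (c i).
  have : 0 < W / m.+1%:R ^+ 2 by rewrite divr_gt0 ?exprn_gt0.
  have := sqr_ge0 (enorm (v - c i)).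
  by move: far; rewrite -mulrA; set w := W / _; split; lra.
exists (fun j => u j + (j == i))%N; split=> [|j|j].
- rewrite big_split/= (_ : \sum_j (j == i) = 1)%N; first by rewrite addn0 addnA leq_add2r.
  by rewrite (bigD1 i)//= eqxx big1// => j /negPf->.
- have [->|_] := eqVneq j i; last by rewrite addn0.
  have [->|[x xC ux]] := uC i; first by rewrite add0n mulnS.
  (* Follows from 4^u W / (m+1)^2 < 4 W by taking roots; doubling it pays for the increment. *)
  suff : (2 ^ u i < 2 * m.+1)%N.
    move=> /ltnW u2.
    by rewrite addn1 expnS -[4%N]/(2 * 2)%N -mulnA leq_mul2l u2 orbT.
  have [_ Wx] := near x xC.
  have : 4 ^+ u i * (W / m.+1%:R ^+ 2) < 4 * W.
    by apply: lt_le_trans ux; rewrite ltr_pM2l ?exprn_gt0.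
  rewrite mulrCA mulrC ltr_pM2r// ltr_pdivrMr ?exprn_gt0//.
  rewrite (_ : 4 = 2 ^+ 2 :> R); last by rewrite -natrX.
  rewrite -exprM mulnC exprM -exprMn -natrX -natrM ltr_sqr ?nnegrE//.
  by rewrite ltr_nat.
- have [->|_] := eqVneq j i; last first.
    rewrite addn0; have [->|[x xC ux]] := uC j; [by left|right; exists x => //].
    by rewrite mem_rcons inE xC orbT.
  right; exists v; first by rewrite mem_rcons mem_head.
  rewrite addn1 exprSr -mulrA.
  (* With [u i] zero there is no older witness, and [|v - c i|^2 <= W] starts the chain. *)
  have [->|[x xC ux]] := uC i; first by rewrite expr0 mul1r ler_pM2l.
  apply: le_trans ux; rewrite ler_pM2l ?exprn_gt0//.
  by have [] := near x xC.
Qed.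

(** Each [u i] is at most 2 + log m, so at most k (2 + log m) openings are uncharged, which is short
    of the threshold 3 k (1 + log m) by at least k. *)
Lemma accounting_phase_end (R : realType) (d k : nat) (c : 'I_k -> 'rV[R]_d)
    (W : R) (C : seq 'rV[R]_d) (m q z : nat) :
  (0 < m)%N -> accounting c W C m q z ->
  3 * k%:R * (1 + log2 m%:R) <= q%:R :> R -> k%:R <= z%:R :> R.
Proof.
move=> m0 [u [qu um _]] ph.
have uL i : (u i)%:R <= 2 + log2 m%:R :> R.
  rewrite -(log2X R 2) -log2M ?ltr0n// -log2X ler_log2//.
  by rewrite -!natrX -natrM ler_nat.
have sL : (\sum_i u i)%:R <= k%:R * (2 + log2 m%:R) :> R.
  rewrite natr_sum mulr_natl -[X in _ *+ X]card_ord -sumr_const.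
  exact: ler_sum.
have : q%:R <= z%:R + (\sum_i u i)%:R :> R by rewrite -natrD ler_nat.
have : 0 <= k%:R * log2 m%:R :> R by rewrite mulr_ge0 ?log2_ge0.
lra.
Qed.

(** * Potential bound on the expected cost *)

(* The factor [4 T / k] makes the [k] or more charged openings of a completed
   phase pay [4 f T], enough for the [2 f T] with which the next one starts. *)
Lemma process_cost_le (R : realType) (d k n : nat) (c : 'I_k -> 'rV[R]_d)
    (g : 'rV[R]_d -> 'I_k) (W : R) (s : seq 'rV[R]_d) (st : state R d) (z : nat)
    (h := fun v => enorm (v - c (g v)) ^+ 2)
    (T := 3 * k%:R * (1 + log2 n%:R) + 1) :
  (0 < k)%N -> 0 < W -> {in s, forall v, h v <= W} ->
  0 < facility st -> centers st != [::] -> (0 < seen st)%N ->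
  (seen st + size s <= n)%N -> (opened st)%:R <= T - 1 ->
  accounting c W (centers st) (seen st) (opened st) z ->
  expect (process k st s) (@assignment_cost R d) <=
    facility st * (T - (opened st)%:R) +
    4 * T / k%:R * (facility st * z%:R +
                    (9 * \sum_(v <- s) h v + 4 * W / (seen st)%:R)).
Proof.
move=> k0 W0.
have K0 : 0 < k%:R :> R by rewrite ltr0n.
elim: s st z => [|v s IH] st z hW f0 C0 m0 mn qT acc;
  have T0 : 1 <= T by have := ler0n R (opened st); lra.
  rewrite /= expect_dret /assignment_cost !big_nil addr_ge0//.
    by rewrite mulr_ge0 ?ltW//; lra.
  rewrite mulr_ge0//; first by rewrite divr_ge0// mulr_ge0//; lra.
  by rewrite mulr0 add0r addr_ge0// ?mulr_ge0 ?invr_ge0// ltW.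
apply: le_trans (process_cost_cons k v s f0 C0) _.
move: st z acc f0 C0 m0 mn qT => [C m f q] z /= acc f0 C0 m0 mn qT.
set p := open_prob _ v.
pose D := dist_to v C ^+ 2; pose e := 9 * h v + 4 * W / m.+1%:R ^+ 2.
pose z' b := (z + (b && (D <= e)%R))%N.
pose E := 9 * \sum_(v <- s) h v + 4 * W / m.+1%:R.
have hv : h v <= W by apply: hW; rewrite mem_head.
(* One bound in terms of the old [f], whether or not the phase ends. *)
have bound b : expect (process k (step k (State C m f q) v b) s)
    (@assignment_cost R d) <=
    f * (T - (q + b)%:R) + 4 * T / k%:R * (f * (z' b)%:R + E).
  have C0' : (if b then rcons C v else C) != [::].
    by case: b => //; case: (C).
  have hWs : {in s, forall v, h v <= W}.
    by move=> w ws; apply: hW; rewrite inE ws orbT.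
  have mn' : (m.+1 + size s <= n)%N by rewrite addSnnS.
  have acc' := accounting_step b W0 hv acc.
  rewrite /step/=; case: ifPn => [ph|]; last first.
    rewrite -ltNge => ph; apply: (IH (State _ _ _ _) (z' b)) => //=.
    rewrite addrK (le_trans (ltW ph))// ler_pM2l ?mulr_gt0// lerD2l.
    rewrite ler_log2 ?ltr0n// ler_nat; exact: leq_trans (leq_addr _ _) mn'.
  have kz := accounting_phase_end (ltn0Sn m) acc' ph; rewrite -/(z' b) in kz.
  apply: le_trans (IH (State _ _ _ _) 0%N _ _ _ _ _ _ _) _ => //=.
  - by rewrite mulr_gt0.
  - by rewrite subr_ge0.
  - exact: accounting0.
  rewrite -/E mulr0 add0r subr0 [X in _ <= _ + X]mulrDr addrA lerD2r.
  (* The summand 1 of [T] is room for the opening that crosses the threshold. *)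
  have qb : (q + b)%:R <= T.
    by rewrite natrD -(subrK 1 T) lerD// (ler_nat _ _ 1); case: (b).
  have : 4 * f * T <= 4 * T / k%:R * (f * (z' b)%:R).
    rewrite (_ : _ * (f * _) = 4 * f * T * ((z' b)%:R / k%:R)); last by field; lra.
    by rewrite ler_peMr ?ler_pdivlMr ?mul1r// !mulr_ge0 ?ltW//; lra.
  have : 0 <= f * (T - (q + b)%:R) by rewrite mulr_ge0 ?(ltW f0)// subr_ge0.
  have : 0 <= f * T by rewrite mulr_ge0 ?ltW//; lra.
  lra.
have p0 : 0 <= p by rewrite le_min ler01 divr_ge0 ?sqr_ge0// ltW.
have p1 : 0 <= 1 - p by rewrite subr_ge0 ge_min lexx orbT.
have pfD : p * f <= D by rewrite -ler_pdivlMr// ge_min lexx.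
(* A charge is made only when [D <= e], and then [p * f <= D]. *)
have chE : p * f * (D <= e)%R%:R <= e.
  case: (leP D e) => [De|_]; first by rewrite /= mulr1 (le_trans pfD).
  rewrite /= mulr0 addr_ge0//; first by rewrite mulr_ge0// /h sqr_ge0.
  by rewrite divr_ge0 ?exprn_ge0// mulr_ge0// ltW.
(* Telescoping: 1/(m+1)^2 + 1/(m+1) <= 1/m. *)
have eE : e + E <= 9 * \sum_(w <- v :: s) h w + 4 * W / m%:R.
  have M0 : 0 < m%:R :> R by rewrite ltr0n.
  rewrite big_cons mulrDr /e /E addrACA lerD2l -mulrDr.
  rewrite ler_pM2l ?mulr_gt0// -natr1.
  rewrite -subr_ge0 (_ : _ - _ = (m%:R * (m%:R + 1) ^+ 2)^-1).
    by rewrite invr_ge0 mulr_ge0 ?exprn_ge0//; lra.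
  by field; lra.
(* The [f] paid on opening cancels the drop of [f * (T - q)]; the charge that remains is covered by
   [chE] and [eE]. *)
have := ler_wpM2l p0 (bound true); have := ler_wpM2l p1 (bound false).
rewrite /z' /= addn0 addn0 !natrD.
have Q0 : 0 <= 4 * T / k%:R by rewrite divr_ge0//; lra.
have := ler_wpM2l Q0 chE; have := ler_wpM2l Q0 eE.
set Q := 4 * T / k%:R; set X := 9 * _ + _; set b := (D <= e)%R%:R.
set V1 := expect _ _; set V0 := expect _ _.
lra.
Qed.

(** * Initial centers and the optimal clustering *)

(** The last clause shows that the initial set is full: a smaller one would contain every distinct
    vector of the stream. *)
Lemma split_streamP (R : realType) (d j : nat) (C s : seq 'rV[R]_d)
    (C' := (split_stream j C s).1) :
  uniq C -> (size C <= j)%N ->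
  [/\ uniq C', (size C' <= j)%N, {subset C <= C'} &
      (size C' < j)%N -> {subset s <= C'}].
Proof.
rewrite {}/C'; elim: s C => [|v s IH] C uC Cj /=; first by split.
case: ifPn => [/andP[Cj' vC]|vC]; last first.
  have [] := IH C uC Cj.
  case: split_stream => C' r /= uC' C'j CC' sub; split=> // C'lt x.
  rewrite inE => /predU1P[->|/(sub C'lt)//].
  move: vC; rewrite negb_and negbK => /orP[|/CC'//].
  by rewrite (leq_ltn_trans (uniq_leq_size uC CC') C'lt).
have [||uC' C'j CC' sub] := IH (rcons C v); rewrite ?rcons_uniq ?vC ?size_rcons//.
split=> // [x xC|C'lt x]; first by apply: CC'; rewrite mem_rcons inE xC orbT.
rewrite inE => /predU1P[->|/(sub C'lt)//].
by apply: CC'; rewrite mem_rcons mem_head.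
Qed.

Lemma shared_cluster (T : eqType) (k : nat) (g : T -> 'I_k) (C : seq T) :
  uniq C -> (k < size C)%N ->
  exists x y, [/\ x \in C, y \in C, x != y & g x = g y].
Proof.
move=> uC kC; apply: contrapT => H; suff : (size C <= k)%N by rewrite leqNgt kC.
have inj : {in C &, injective g}.
  move=> x y xC yC gxy; apply/eqP/negP => /negP xy.
  by apply: H; exists x, y.
rewrite -(size_map g) -[X in (_ <= X)%N]card_ord -(card_uniqP _) ?max_card//.
by rewrite map_inj_in_uniq.
Qed.

(** By pigeonhole two distinct vectors share a cluster; going through its center gives (3 + 3/2) / 2
    = 9/4. The two bounds together also yield [0 < W]. *)
Lemma wstar0_bounds (R : realType) (d k : nat) (c : 'I_k -> 'rV[R]_d)
    (g : 'rV[R]_d -> 'I_k) (C : seq 'rV[R]_d) (W : R) :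
  uniq C -> (k < size C)%N ->
  {in C, forall v, enorm (v - c (g v)) ^+ 2 <= W} ->
  0 < wstar0 C <= 9 / 4 * W.
Proof.
move=> uC kC hW; have [x [y [xC yC xy gxy]]] := shared_cluster g uC kC.
rewrite /wstar0; set P := [seq p <- _ | _].
have xyP : (x, y) \in P.
  by rewrite mem_filter xy; apply/allpairsP; exists (x, y).
apply/andP; split.
  have: [seq enorm (p.1 - p.2) ^+ 2 / 2 | p <- P] != [::] by case: P xyP.
  move=> /seqmin_mem/mapP[p pP ->]; rewrite divr_gt0// lt0r sqr_ge0 andbT.
  move: pP; rewrite mem_filter => /andP[p12 _].
  by apply: contra_neq p12 => /enorm_eq0/eqP; rewrite subr_eq0 => /eqP.
apply: le_trans (seqmin_le _ : _ <= enorm (x - y) ^+ 2 / 2) _.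
  exact: (map_f (fun p : 'rV[R]_d * 'rV[R]_d => enorm (p.1 - p.2) ^+ 2 / 2) xyP).
have := sqr_enormB_le x y (c (g x)); have := hW _ xC; have := hW _ yC.
by rewrite -gxy; lra.
Qed.

(** Sending each vector to its nearest optimal center replaces an assignment of positions by a
    function of vectors. *)
Lemma kmeans_opt_assignment (R : realType) (d k n : nat) (v : n.-tuple 'rV[R]_d) :
  (0 < k)%N ->
  exists (c : 'I_k -> 'rV[R]_d) (g : 'rV[R]_d -> 'I_k),
    \sum_(x <- v) enorm (x - c (g x)) ^+ 2 <= kmeans_opt k v.
Proof.
move=> k0; have [a [c [-> _]]] := kmeans_opt_attained v k0.
pose g x := [arg min_(i < Ordinal k0) enorm (x - c i) ^+ 2]%O.
exists c, g; rewrite big_tuple /kmeans_cost.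
rewrite (partition_big a xpredT)//=; apply: ler_sum => i _; apply: ler_sum => t _.
by rewrite /g; case: arg_minP => //= j _; apply.
Qed.

Theorem theorem4 (R : realType) :
  exists2 A : R, 0 < A &
  forall (d k n : nat) (v : n.-tuple 'rV[R]_d),
    (1 <= k)%N ->
    (k.+1 <= size (undup v))%N ->
    expect (online_kmeans k v) (@assignment_cost R d)
      <= A * (kmeans_opt k v * log2 n%:R).
Proof.
(* 385 = 55 * 7: [T] is at most 7 k log n, and 55 rounds up 9/4 + 4 * (9 + 4), from the initial
   facility cost and the charged openings. *)
exists 385 => // d k n v k0 kv.
have [c [g hW]] := kmeans_opt_assignment v k0; set W := kmeans_opt k v in hW *.
set h := fun x => enorm (x - c (g x)) ^+ 2.
have h0 x : 0 <= h x by exact: sqr_ge0.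
rewrite /online_kmeans; have perm := perm_split_stream k.+1 [::] v.
have [] := @split_streamP R d k.+1 [::] v isT isT.
case: split_stream perm => C rest /= perm uC Ck _ sub.
have {sub Ck} sC : size C = k.+1.
  apply/eqP; rewrite eqn_leq Ck/= leqNgt; apply/negP => /[dup] lt /sub sub'.
  have : (size (undup v) <= size C)%N.
    by apply: uniq_leq_size (undup_uniq _) _ => x; rewrite mem_undup => /sub'.
  by move: kv lt; lia.
have nE : (size C + size rest = n)%N.
  by rewrite -size_cat (perm_size perm) size_tuple.
have sumW : \sum_(x <- C) h x + \sum_(x <- rest) h x <= W.
  by rewrite -big_cat/= (perm_big _ perm).
have hmem (s : seq 'rV[R]_d) x : x \in s -> h x <= \sum_(y <- s) h y.
  by move=> xs; rewrite (big_rem x)//= lerDl sumr_ge0.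
have sum0 (s : seq 'rV[R]_d) : 0 <= \sum_(y <- s) h y by exact: sumr_ge0.
have hC : {in C, forall x, h x <= W}.
  by move=> x /hmem; have := sum0 rest; lra.
have hrest : {in rest, forall x, h x <= W}.
  by move=> x /hmem; have := sum0 C; lra.
have kC : (k < size C)%N by rewrite sC.
have /andP[w0 wW] := wstar0_bounds uC kC hC.
have W0 : 0 < W by lra.
have K0 : 0 < k%:R :> R by rewrite ltr0n.
(* As n >= k + 1 >= 2, the logarithm can absorb additive constants. *)
have L1 : 1 <= log2 n%:R :> R.
  by rewrite -[leLHS]/(1%:R) -(log2X R 1) ler_log2// ler_nat -nE sC; lia.
have -> : expect (dbind (process k (init_state k C) rest)
      (fun out => dret R ([seq (c, c) | c <- C] ++ out))) (@assignment_cost R d)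
    = expect (process k (init_state k C) rest) (@assignment_cost R d).
  rewrite expect_dbind /expect; apply: eq_bigr => w _; congr (_ * _).
  rewrite -/(expect _ _) expect_dret /assignment_cost big_cat big_map/=.
  rewrite big1 ?add0r// => x _.
  by rewrite subrr sqr_enorm big1// => j _; rewrite mxE expr0n.
set T := 3 * k%:R * (1 + log2 n%:R) + 1 : R.
have T0 : 0 <= T - 1 by rewrite addrK !mulr_ge0//; lra.
have := @process_cost_le R d k n c g W rest (init_state k C) 0 k0 W0 hrest.
rewrite /= -/T -/h => H; apply: le_trans (H _ _ _ _ _ _) _ => //.
- by rewrite divr_gt0.
- by case: (C) sC.
- by rewrite -nE sC.
- exact: accounting0.
rewrite subr0 mulr0 add0r.
have Wk : 4 * W / k.+1%:R <= 4 * W.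
  by rewrite ler_pdivrMr// ler_peMr ?ler1n// mulr_ge0// ltW.
have TK : T <= 7 * k%:R * log2 n%:R.
  have k1 : 1 <= k%:R :> R by rewrite ler1n.
  have : k%:R <= k%:R * log2 n%:R :> R by rewrite ler_peMr// ltW.
  by rewrite /T; lra.
have -> : 385 * (W * log2 n%:R) = 55 * W / k%:R * (7 * k%:R * log2 n%:R).
  by field; lra.
apply: (@le_trans _ _ (55 * W / k%:R * T)); last first.
  by rewrite ler_pM2l// divr_gt0// mulr_gt0.
rewrite (_ : _ + _ = (wstar0 C + 4 * (9 * \sum_(x <- rest) h x + 4 * W / k.+1%:R))
   / k%:R * T); last by field; rewrite !gt_eqF//= ?ltr0n.
rewrite ler_pM2r; last lra.
rewrite ler_pM2r ?invr_gt0//.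
by move: Wk (sum0 C) (sum0 rest) sumW; set w := 4 * W / _; lra.
Qed.
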